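(* Let $F$ be an algebraically closed field of characteristic $0$, $k\ge1$, $G=\mathbb{Z}_2^{2k}$, $\beta(a,b)=(-1)^{\sum_{i=1}^k(a_{2i}b_{2i-1}-a_{2i-1}b_{2i})}$ for $a,b\in G$, and let $f_0,f_1:G\to\mathbb{F}_2$ be $f_0(a)=\sum_{i=1}^k a_{2i-1}a_{2i}$ and $f_1(a)=a_1^2+a_2^2+\sum_{i=1}^k a_{2i-1}a_{2i}$. Let $(M,* )=\bigotimes_{i=1}^k(M(2,F),*_i)$, where $*_i$ is the involution attached to a nonsingular bilinear form $\phi_i$ on $F^2$, with its $G$-grading and the graded isomorphism $\psi:F^\xi G\to M\cong M(2^k,F)$ described in the context, and let $\phi=\phi_1\otimes\cdots\otimes\phi_k$. (1) Assume the number of skew-symmetric factors $\phi_i$ in $\phi$ is $0$ and the matrix of each $\phi_i$ is $I_2$. Then $K(M,* )\cong\mathfrak{so}(2^k,F)$ and $H(M,* )$ is a Jordan algebra of type $H(F_{2^k})$. (1.1) The support of $K(M,* )$ is $R_0^-=\{a\in G\setminus\{0\}\mid f_0(a)=1\}$ and the support of $H(M,* )$ is $R_0^+=\{a\in G\mid f_0(a)=0\}$. (1.2) Conversely, $R_0^-$ is a skew root system of Lie type in $(G,\beta)$ for $k\ge2$ and $R_0^+$ is a skew root system of Jordan type in $(G,\beta)$ for $k\ge1$. The isomorphism $\psi$ induces a Lie algebra isomorphism $L(R_0^-)\to K(M,* )\cong\mathfrak{so}(2^k,F)$ for $k\ge2$ and a Jordan algebra isomorphism $J(R_0^+)\to H(M,*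 )$ for $k\ge1$. (2) Assume the number of skew-symmetric factors $\phi_i$ in $\phi$ is $1$, the matrix of $\phi_1$ is $\Phi_1=\begin{pmatrix}0&1\\-1&0\end{pmatrix}$ and the matrix of $\phi_i$ is $I_2$ for $i>1$. Then $K(M,* )\cong\mathfrak{sp}(2^k,F)$ and $H(M,* )$ is a Jordan algebra of type $H(Q_{2^k})$. (2.1) The support of $K(M,* )$ is $R_1^-=\{a\in G\setminus\{0\}\mid f_1(a)=1\}$ and the support of $H(M,* )$ is $R_1^+=\{a\in G\mid f_1(a)=0\}$. (2.2) Conversely, $R_1^-$ is a skew root system of Lie type in $(G,\beta)$ for $k\ge1$ and $R_1^+$ is a skew root system of Jordan type in $(G,\beta)$ for $k\ge2$. The isomorphism $\psi$ induces a Lie algebra isomorphism $L(R_1^-)\to K(M,* )\cong\mathfrak{sp}(2^k,F)$ for $k\ge1$ and a Jordan algebra isomorphism $J(R_1^+)\to H(M,* )$ for $k\ge2$.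
   Context: Skew root systems. For an alternating bicharacter $\beta$ on $G$ ($\mathbb{Z}$-bilinear into $F^\times$ with $\beta(g,g)=1$), $\mathrm{Rad}(\beta)=\{g:\beta(g,h)=1\ \forall h\in G\}$. $R\subseteq G$ is a skew root system of Lie type in $(G,\beta)$ if $\mathrm{Rad}(\beta)\ne G$ and: $R\subseteq G\setminus\mathrm{Rad}(\beta)$ generates $G$; $R=-R$; and $a,b\in R$, $\beta(a,b)\ne1$ imply $a+b\in R$. A nonempty $R\subseteq G$ is a skew root system of Jordan type in $(G,\beta)$ if: $R$ generates $G$; $R=-R$; and $a,b\in R$, $\beta(a,b)\neq-1$ imply $a+b\in R$. For a 2-cocycle $\xi$ on $G$ with $\xi(a,b)\xi(b,a)^{-1}=\beta(a,b)$, $F^\xi G$ is the associative algebra with basis $\{u_g\}_{g\in G}$ and $u_au_b=\xi(a,b)u_{a+b}$. For $R$ of Lie type $L(R)=\bigoplus_{a\in R}Fu_a\subseteq F^\xi G$ with $[x,y]=xy-yx$; for $R$ of Jordan type $J(R)=\bigoplus_{a\in R}Fu_a\subseteq F^\xi G$ with $x\circ y=\frac12(xy+yx)$. Involutions. A nonsingular symmetric or skew-symmetric bilinear form $\phi$ on $F^n$ defines an involution (involutive anti-automorphism) $*$ on $M(n,F)$ by $\phi(Xu,v)=\phi(u,X^*v)$; if $\Phi$ is the matrix of $\phi$ then $X^*=\Phi^{-1}X^t\Phi$. For a matrix algebra $M$ with involution $*$, $K(M,* )=\{X\in M:X^*=-X\}$ is a Lie algebra under $[X,Y]=XY-YX$,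 and $H(M,* )=\{X\in M:X^*=X\}$ is a Jordan algebra under $X\circ Y=\frac12(XY+YX)$. If $*$ comes from a nonsingular symmetric form on $F^n$, $H(M(n,F),* )$ is called a Jordan algebra of type $H(F_n)$; if $*$ comes from a nonsingular skew-symmetric form on $F^{n}$ ($n$ even), it is called a Jordan algebra of type $H(Q_n)$. The tensor product $(M_1,*_1)\otimes(M_2,*_2)$ is $M_1\otimes M_2$ with involution $(C\otimes B)\mapsto C^{*_1}\otimes B^{*_2}$; the involution $*$ on $M=\bigotimes_i M(2,F)$ corresponds to $\phi=\phi_1\otimes\cdots\otimes\phi_k$ on $(F^2)^{\otimes k}\cong F^{2^k}$. Grading. Let $X=\begin{pmatrix}-1&0\\0&1\end{pmatrix}$, $Y=\begin{pmatrix}0&1\\1&0\end{pmatrix}$. $M=M(2,F)^{\otimes k}\cong M(2^k,F)$ is $G$-graded with $M_{(i_1,j_1,\dots,i_k,j_k)}=F\cdot X^{i_1}Y^{j_1}\otimes\cdots\otimes X^{i_k}Y^{j_k}$. This grading is compatible with $*$ ($M_g^*=M_g$), so $K(M,* )$ and $H(M,* )$ are $G$-graded by restriction; the support of a grading is the set of $g\in G$ with nonzero homogeneous component. Take $\xi(a,b)=(-1)^{\sum_{t=1}^k a_{2t}b_{2t-1}}$, a 2-cocycle corresponding to $\beta$; the $G$-graded algebra isomorphism $\psi:F^\xi G\to M$ is $u_{(i_1,j_1,\dots,i_k,j_k)}\mapsto X^{i_1}Y^{j_1}\otimes\cdots\otimes X^{i_k}Y^{j_k}$. *)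

(* Defs.v *)
From HB Require Import structures.
From mathcomp Require Import all_boot all_order all_algebra all_fingroup.
From mathcomp Require Import sesquilinear mxtens.
Set Implicit Arguments.
Unset Strict Implicit.
Unset Printing Implicit Defensive.
Import GRing.Theory.
Local Open Scope ring_scope.

Record alternating_bicharacter (G : zmodType) (F : fieldType) := {
  bichar :> G -> G -> F;
  bichar_neq0 : forall a b, bichar a b != 0;
  bicharDl : forall a b c, bichar (a + b) c = bichar a c * bichar b c;
  bicharDr : forall a b c, bichar a (b + c) = bichar a b * bichar a c;
  bichar_alt : forall a, bichar a a = 1 }.

Section SkewRootSystems.
Variables (G : finZmodType) (F : fieldType) (beta : alternating_bicharacter G F).

Definition Rad : {set G} := [set g | [forall h, beta g h == 1]].

(* [<<R>>] is generation in the finite group (G, +). *)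
Definition skew_root_Lie (R : {set G}) : Prop :=
  (Rad != [set: G]) /\
  [/\ R \subset ~: Rad,
      <<R>>%g = [set: G],
      [set - a | a in R] = R
    & {in R &, forall a b, beta a b != 1 -> a + b \in R}].

Definition skew_root_Jordan (R : {set G}) : Prop :=
  [/\ R != set0,
      <<R>>%g = [set: G],
      [set - a | a in R] = R
    & {in R &, forall a b, beta a b != -1 -> a + b \in R}].

End SkewRootSystems.

Record two_cocycle (G : zmodType) (F : fieldType) := {
  cocycle :> G -> G -> F;
  cocycle_neq0 : forall a b, cocycle a b != 0;
  cocycleP : forall a b c,
    cocycle a b * cocycle (a + b) c = cocycle b c * cocycle a (b + c) }.

(* An element is the family of its coordinates in the basis (u_g). *)
Definition tga (G : finZmodType) (F : fieldType) (xi : two_cocycle G F) : Type :=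
  {ffun G -> F^o}.

Section TwistedGroupAlgebra.
Variables (G : finZmodType) (F : fieldType) (xi : two_cocycle G F).

HB.instance Definition _ := Vector.copy (tga xi) {ffun G -> F^o}.

Definition tga_u (g : G) : tga xi := [ffun h => (h == g)%:R].

Definition tga_mul (x y : tga xi) : tga xi :=
  \sum_a \sum_b (x a * y b * xi a b) *: tga_u (a + b).

(* The unit element need not be u_0, as xi is not assumed normalized. *)
Definition tga_one : tga xi := (xi 0 0)^-1 *: tga_u 0.

Let U : G -> tga xi := tga_u.

Lemma tga_sum (x : tga xi) : x = \sum_a x a *: U a.
Proof.
apply/ffunP=> h; rewrite sum_ffunE (bigD1 h) //= big1 => [|i ih].
  by rewrite addr0 !ffunE eqxx /GRing.scale /= mulr1.
by rewrite !ffunE eq_sym (negPf ih) /GRing.scale /= mulr0.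
Qed.

Lemma tga_mulDl : left_distributive tga_mul +%R.
Proof.
move=> x y z; rewrite /tga_mul -big_split; apply: eq_bigr => a _.
rewrite -big_split; apply: eq_bigr => b _.
by rewrite /= -scalerDl ffunE !mulrDl.
Qed.

Lemma tga_mulDr : right_distributive tga_mul +%R.
Proof.
move=> x y z; rewrite /tga_mul -big_split; apply: eq_bigr => a _.
rewrite -big_split; apply: eq_bigr => b _.
by rewrite /= -scalerDl ffunE !(mulrDl, mulrDr).
Qed.

Lemma tga_scaleAl (c : F) (x y : tga xi) : c *: tga_mul x y = tga_mul (c *: x) y.
Proof.
rewrite /tga_mul scaler_sumr; apply: eq_bigr => a _.
rewrite scaler_sumr; apply: eq_bigr => b _.
by rewrite scalerA ffunE /GRing.scale /= !mulrA.
Qed.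

Lemma tga_scaleAr (c : F) (x y : tga xi) : c *: tga_mul x y = tga_mul x (c *: y).
Proof.
rewrite /tga_mul scaler_sumr; apply: eq_bigr => a _.
rewrite scaler_sumr; apply: eq_bigr => b _.
by rewrite scalerA ffunE /GRing.scale /= (mulrCA (x a)) !mulrA.
Qed.

Lemma tga_mul_u a b : tga_mul (tga_u a) (tga_u b) = xi a b *: tga_u (a + b).
Proof.
rewrite /tga_mul (bigD1 a) //= [X in _ + X]big1 ?addr0 => [|i ia].
  rewrite (bigD1 b) //= big1 ?addr0 => [|i ib].
    by rewrite !ffunE !eqxx !mul1r.
  by rewrite !ffunE (negPf ib) mulr0 mul0r scale0r.
by apply: big1 => j _; rewrite !ffunE (negPf ia) !mul0r scale0r.
Qed.

Let mul0l x : tga_mul 0 x = 0.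
Proof.
by apply: (addrI (tga_mul 0 x)); rewrite -tga_mulDl !addr0.
Qed.

Let mul0r' x : tga_mul x 0 = 0.
Proof.
by apply: (addrI (tga_mul x 0)); rewrite -tga_mulDr !addr0.
Qed.

Let suml (I : Type) (r : seq I) (E : I -> tga xi) y :
  tga_mul (\sum_(i <- r) E i) y = \sum_(i <- r) tga_mul (E i) y.
Proof.
by elim: r => [|i r IH]; rewrite ?big_nil ?mul0l // !big_cons tga_mulDl IH.
Qed.

Let sumr (I : Type) (r : seq I) (E : I -> tga xi) y :
  tga_mul y (\sum_(i <- r) E i) = \sum_(i <- r) tga_mul y (E i).
Proof.
by elim: r => [|i r IH]; rewrite ?big_nil ?mul0r' // !big_cons tga_mulDr IH.
Qed.

Lemma tga_mulA : associative tga_mul.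
Proof.
move=> x y z.
have -> : x = \sum_a x a *: U a by exact: tga_sum.
rewrite (suml _ _ y) (suml _ _ z) (suml _ _ (tga_mul y z)).
apply: eq_bigr => a _; rewrite -!(tga_scaleAl (x a)); congr (_ *: _).
have -> : y = \sum_b y b *: U b by exact: tga_sum.
rewrite (suml _ _ z) (sumr _ _ (U a)) (sumr _ _ (U a)) (suml _ _ z).
apply: eq_bigr => b _.
rewrite -(tga_scaleAl (y b)) -!(tga_scaleAr (y b)) -(tga_scaleAl (y b)).
congr (_ *: _).
have -> : z = \sum_c z c *: U c by exact: tga_sum.
rewrite (sumr _ _ (U b)) (sumr _ _ (U a)) (sumr _ _ (tga_mul (U a) (U b))).
apply: eq_bigr => c _; rewrite -!(tga_scaleAr (z c)); congr (_ *: _).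
rewrite !tga_mul_u -tga_scaleAl -tga_scaleAr !tga_mul_u !scalerA addrA.
by rewrite cocycleP.
Qed.

Let cocycle0l a : xi 0 a = xi 0 0.
Proof.
have := cocycleP xi 0 0 a; rewrite !add0r.
by move/(mulIf (cocycle_neq0 xi 0 a)).
Qed.

Let cocycle0r a : xi a 0 = xi 0 0.
Proof.
have := cocycleP xi a 0 0; rewrite !addr0.
by move/(mulIf (cocycle_neq0 xi a 0)).
Qed.

Lemma tga_mul1l : left_id tga_one tga_mul.
Proof.
move=> x; rewrite (tga_sum x) sumr; apply: eq_bigr => a _.
rewrite -tga_scaleAr -tga_scaleAl tga_mul_u add0r cocycle0l !scalerA.
by rewrite divfK ?cocycle_neq0.
Qed.

Lemma tga_mul1r : right_id tga_one tga_mul.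
Proof.
move=> x; rewrite (tga_sum x) suml; apply: eq_bigr => a _.
rewrite -tga_scaleAl -tga_scaleAr tga_mul_u addr0 cocycle0r !scalerA.
by rewrite divfK ?cocycle_neq0.
Qed.

Lemma tga_one_neq0 : tga_one != 0.
Proof.
apply/eqP => /ffunP /(_ 0); rewrite !ffunE eqxx /GRing.scale /= mulr1.
by apply/eqP; rewrite invr_eq0 cocycle_neq0.
Qed.

HB.instance Definition _ := GRing.Zmodule_isNzRing.Build (tga xi)
  tga_mulA tga_mul1l tga_mul1r tga_mulDl tga_mulDr tga_one_neq0.
HB.instance Definition _ := GRing.Lmodule_isLalgebra.Build F (tga xi) tga_scaleAl.
HB.instance Definition _ := GRing.Lalgebra_isAlgebra.Build F (tga xi) tga_scaleAr.

(* The underlying space of both L(R) and J(R). *)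
Definition tga_span (R : {set G}) : {vspace tga xi} :=
  (\sum_(a in R) <[tga_u a]>)%VS.

End TwistedGroupAlgebra.

Section LieJordanIsomorphisms.
Variable F : fieldType.

Definition lie_mul (V : lmodType F) (mul : V -> V -> V) (x y : V) : V :=
  mul x y - mul y x.

Definition jordan_mul (V : lmodType F) (mul : V -> V -> V) (x y : V) : V :=
  2^-1 *: (mul x y + mul y x).

(* [A] and [B] are subalgebras of (U, mulU) and (V, mulV), and the restriction
   of [f] to [A] is an isomorphism of algebras from [A] onto [B]. *)
Definition induces_iso (U V : vectType F) (mulU : U -> U -> U)
    (mulV : V -> V -> V) (A : {vspace U}) (B : {vspace V}) (f : 'Hom(U, V)) :=
  [/\ {in A &, forall x y, mulU x y \in A},
      {in B &, forall x y, mulV x y \in B},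
      {in A &, injective f},
      (f @: A)%VS = B
    & {in A &, {morph f : x y / mulU x y >-> mulV x y}}].

End LieJordanIsomorphisms.

Section Involutions.
Variable F : fieldType.

Section Forms.
Variables (n : nat) (phi : {biscalar 'cV[F]_n}).

Definition form_nonsingular : Prop :=
  forall u, (forall v, phi u v = 0) -> u = 0.

Definition form_symmetric : Prop := forall u v, phi u v = phi v u.

Definition form_skew : Prop := forall u v, phi u v = - phi v u.

Definition form_mx : 'M[F]_n :=
  \matrix_(i, j) phi (delta_mx i 0) (delta_mx j 0).

Definition involution_of_form (inv : 'M[F]_n -> 'M[F]_n) : Prop :=
  forall X u v, phi (X *m u) v = phi u (inv X *m v).

End Forms.

Definition number_of_skew_forms (I : finType) (n : nat)
    (phi : I -> {biscalar 'cV[F]_n}) (m : nat) : Prop :=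
  exists2 S : {set I}, (forall i, i \in S <-> form_skew (phi i)) & #|S| = m.

Section KH.
Variables (n : nat) (star : 'End('M[F]_n)).

Definition Kspace : {vspace 'M[F]_n} := lker (star + \1)%VF.
Definition Hspace : {vspace 'M[F]_n} := lker (star - \1)%VF.

Lemma mem_Kspace X : (X \in Kspace) = (star X == - X).
Proof. by rewrite memv_ker add_lfunE id_lfunE addr_eq0. Qed.

Lemma mem_Hspace X : (X \in Hspace) = (star X == X).
Proof. by rewrite memv_ker add_lfunE opp_lfunE id_lfunE subr_eq0. Qed.

End KH.

Definition Jordan_type_HF (n : nat) (J : {vspace 'M[F]_n}) : Prop :=
  exists (phi : {biscalar 'cV[F]_n}) (star : 'End('M[F]_n)),
    [/\ form_nonsingular phi, form_symmetric phi,
        involution_of_form phi star & J = Hspace star].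

Definition Jordan_type_HQ (n : nat) (J : {vspace 'M[F]_n}) : Prop :=
  ~~ odd n /\
  exists (phi : {biscalar 'cV[F]_n}) (star : 'End('M[F]_n)),
    [/\ form_nonsingular phi, form_skew phi,
        involution_of_form phi star & J = Hspace star].

Definition Lie_iso (n m : nat) (A : {vspace 'M[F]_n}) (B : {vspace 'M[F]_m}) :=
  exists f : 'Hom('M[F]_n, 'M[F]_m),
    induces_iso (lie_mul mulmx) (lie_mul mulmx) A B f.

Definition so (n : nat) : {vspace 'M[F]_n} := lker (linfun trmx + \1)%VF.

Lemma mem_so n (X : 'M[F]_n) : (X \in so n) = (X^T == - X).
Proof. by rewrite memv_ker add_lfunE id_lfunE lfunE addr_eq0. Qed.

Definition symplectic_mx (m : nat) : 'M[F]_(m + m) :=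
  block_mx 0 1%:M (- 1%:M) 0.

Definition sp_map (m : nat) (X : 'M[F]_(m + m)) : 'M[F]_(m + m) :=
  X^T *m symplectic_mx m + symplectic_mx m *m X.

Fact sp_map_linear m : linear (@sp_map m).
Proof.
move=> c X Y; rewrite /sp_map linearP /= mulmxDl mulmxDr -scalemxAl -scalemxAr.
by rewrite scalerDr addrACA.
Qed.
HB.instance Definition _ m :=
  GRing.isLinear.Build F _ _ _ (@sp_map m) (@sp_map_linear m).

Definition Phi1 : 'M[F]_2 :=
  \matrix_(r, s) (if r == s then 0 else if r == 0 then 1 else -1).

(* sp(2m, F) *)
Definition sp (m : nat) : {vspace 'M[F]_(m + m)} := lker (linfun (@sp_map m)).

Lemma mem_sp m (X : 'M[F]_(m + m)) :
  (X \in sp m) = (X^T *m symplectic_mx m == - (symplectic_mx m *m X)).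
Proof. by rewrite memv_ker lfunE addr_eq0. Qed.

(* The element C_1 (x) ... (x) C_k of M(2, F)^{(x) k} = M(2^k, F), the
   identification being the Kronecker product with first factor outermost. *)
Fixpoint kron (k : nat) : ('I_k -> 'M[F]_2) -> 'M[F]_(2 ^ k) :=
  match k return ('I_k -> 'M[F]_2) -> 'M[F]_(2 ^ k) with
  | 0 => fun _ => 1%:M
  | k'.+1 => fun C =>
      castmx (esym (expnS 2 k'), esym (expnS 2 k'))
        (tensmx (C ord0) (kron (fun i => C (lift ord0 i))))
  end.

(* As the pure tensors span M(2^k, F), [star] is determined by the family. *)
Definition tensor_involution (k : nat) (inv : 'I_k -> 'M[F]_2 -> 'M[F]_2)
    (star : 'End('M[F]_(2 ^ k))) : Prop :=
  forall C : 'I_k -> 'M[F]_2, star (kron C) = kron (fun i => inv i (C i)).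

End Involutions.

Section Grading.
Variable k : nat.

Local Notation G2 := 'rV['F_2]_(2 * k).

(* Coordinates are numbered from 1 to 2k. *)
Definition coor (a : G2) (j : nat) : 'F_2 := oapp (a 0) 0 (insub j.-1).

Lemma coorD a b j : coor (a + b) j = coor a j + coor b j.
Proof. by rewrite /coor; case: insub => [i|] /=; rewrite ?mxE ?addr0. Qed.

Definition f0 (a : G2) : 'F_2 :=
  \sum_(1 <= i < k.+1) coor a i.*2.-1 * coor a i.*2.

Definition f1 (a : G2) : 'F_2 :=
  coor a 1 ^+ 2 + coor a 2 ^+ 2 +
  \sum_(1 <= i < k.+1) coor a i.*2.-1 * coor a i.*2.

Definition R0minus : {set G2} := [set a | (a != 0) && (f0 a == 1)].
Definition R0plus : {set G2} := [set a | f0 a == 0].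
Definition R1minus : {set G2} := [set a | (a != 0) && (f1 a == 1)].
Definition R1plus : {set G2} := [set a | f1 a == 0].

Variable F : fieldType.

Definition sgn2 (x : 'F_2) : F := (-1) ^+ (x : nat).

Lemma sgn2D x y : sgn2 (x + y) = sgn2 x * sgn2 y.
Proof. by rewrite /sgn2 -exprD /= modn2 signr_odd. Qed.

Lemma sgn2_neq0 x : sgn2 x != 0.
Proof. by rewrite signr_eq0. Qed.

Definition beta_exp (a b : G2) : 'F_2 :=
  \sum_(1 <= i < k.+1)
    (coor a i.*2 * coor b i.*2.-1 - coor a i.*2.-1 * coor b i.*2).

Definition xi_exp (a b : G2) : 'F_2 :=
  \sum_(1 <= t < k.+1) coor a t.*2 * coor b t.*2.-1.

Definition beta_fun (a b : G2) : F := sgn2 (beta_exp a b).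
Definition xi_fun (a b : G2) : F := sgn2 (xi_exp a b).

Fact beta_fun_neq0 a b : beta_fun a b != 0. Proof. exact: sgn2_neq0. Qed.

Fact beta_funDl a b c : beta_fun (a + b) c = beta_fun a c * beta_fun b c.
Proof.
rewrite -sgn2D /beta_fun /beta_exp -big_split.
congr sgn2; apply: eq_bigr => i _ /=.
by rewrite !coorD !mulrDl opprD addrACA.
Qed.

Fact beta_funDr a b c : beta_fun a (b + c) = beta_fun a b * beta_fun a c.
Proof.
rewrite -sgn2D /beta_fun /beta_exp -big_split.
congr sgn2; apply: eq_bigr => i _ /=.
by rewrite !coorD !mulrDr opprD addrACA.
Qed.

Fact beta_fun_alt a : beta_fun a a = 1.
Proof.
by rewrite /beta_fun /beta_exp big1 // => i _; rewrite [X in X - _]mulrC subrr.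
Qed.

Definition beta : alternating_bicharacter G2 F :=
  {| bichar := beta_fun; bichar_neq0 := beta_fun_neq0;
     bicharDl := beta_funDl; bicharDr := beta_funDr;
     bichar_alt := beta_fun_alt |}.

Fact xi_fun_neq0 a b : xi_fun a b != 0. Proof. exact: sgn2_neq0. Qed.

Fact xi_fun_cocycle a b c :
  xi_fun a b * xi_fun (a + b) c = xi_fun b c * xi_fun a (b + c).
Proof.
rewrite -!sgn2D /xi_exp -!big_split; congr sgn2; apply: eq_bigr => i _ /=.
by rewrite !coorD mulrDl mulrDr [LHS]addrA [RHS]addrCA addrAC addrA.
Qed.

Definition xi : two_cocycle G2 F :=
  {| cocycle := xi_fun; cocycle_neq0 := xi_fun_neq0;
     cocycleP := xi_fun_cocycle |}.

Fact xi_beta a b : xi a b / xi b a = beta a b.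
Proof.
apply: (canLR (mulfK (xi_fun_neq0 b a))).
rewrite /= -sgn2D -big_split; congr sgn2; apply: eq_bigr => i _ /=.
by rewrite [X in _ + X]mulrC subrK.
Qed.

Definition Xmx : 'M[F]_2 :=
  \matrix_(r, s) (if r == s then (if r == 0 then -1 else 1) else 0).
Definition Ymx : 'M[F]_2 := \matrix_(r, s) (if r == s then 0 else 1).

(* X^{i_1} Y^{j_1} (x) ... (x) X^{i_k} Y^{j_k}, for g = (i_1, j_1, ..., i_k, j_k);
   the factors are numbered from 0 by 'I_k. *)
Definition XYmx (g : G2) : 'M[F]_(2 ^ k) :=
  kron (fun i : 'I_k => Xmx ^+ coor g i.*2.+1 *m Ymx ^+ coor g i.*2.+2).

Definition M_component (g : G2) : {vspace 'M[F]_(2 ^ k)} := <[XYmx g]>%VS.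

Definition grading_support (V : {vspace 'M[F]_(2 ^ k)}) : {set G2} :=
  [set g | (V :&: M_component g)%VS != 0%VS].

Definition psi_fun (x : tga xi) : 'M[F]_(2 ^ k) := \sum_g x g *: XYmx g.

Fact psi_fun_linear : linear psi_fun.
Proof.
move=> c x y; rewrite /psi_fun scaler_sumr -big_split; apply: eq_bigr => g _ /=.
by rewrite !ffunE scalerDl scalerA.
Qed.
HB.instance Definition _ := GRing.isLinear.Build F _ _ _ psi_fun psi_fun_linear.

Definition psi : 'Hom(tga xi, 'M[F]_(2 ^ k)) := linfun psi_fun.

Lemma psi_u g : psi (tga_u xi g) = XYmx g.
Proof.
rewrite lfunE /= /psi_fun (bigD1 g) //= big1 => [|h hg].
  by rewrite addr0 ffunE eqxx scale1r.
by rewrite ffunE (negPf hg) scale0r.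
Qed.

Definition psi_induces_Lie_iso (R : {set G2}) (B : {vspace 'M[F]_(2 ^ k)}) :=
  induces_iso (lie_mul (fun x y : tga xi => x * y)) (lie_mul mulmx)
    (tga_span xi R) B psi.

Definition psi_induces_Jordan_iso (R : {set G2}) (B : {vspace 'M[F]_(2 ^ k)}) :=
  induces_iso (jordan_mul (fun x y : tga xi => x * y)) (jordan_mul mulmx)
    (tga_span xi R) B psi.

End Grading.

(* Main.v *)
Require Import Defs.
From mathcomp Require Import all_boot all_order all_algebra all_fingroup.
From HB Require Import structures.
From mathcomp Require Import sesquilinear mxtens ring.
Import GRing.Theory.
Local Open Scope ring_scope.

(** One sign function rules the whole statement. The Kronecker products
    [XYmx g] of the matrices [X^i Y^j] multiply like the twisted group algebra
    ([XYmx_mul]) and have trace zero except for [g = 0] ([mxtrace_XYmx]).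
    Hence the trace form reads off coordinates, [psi] is injective, and since
    both sides have dimension [4^k] it is an isomorphism of algebras
    ([psi_mul], [psi_inj], [limg_psi]).

    Each [XYmx g] is an eigenvector of the involution, with eigenvalue
    [(-1)^(f g)] ([star_XYmx]). For the transpose, [X] and [Y] are symmetric
    and anticommute, so [X^i Y^j] picks up [(-1)^(i j)]: this gives [f = f0].
    For the symplectic form on the first factor, [X] and [Y] are moreover
    turned into their opposites, which adds [i + j] in that slot: this gives
    [f = f1]. Diagonalizing the involution in the basis [XYmx g] identifies
    [K] with the span of the [XYmx g] with [f g = 1] and [H] with the span of
    those with [f g = 0], which yields the supports and the two isomorphisms
    induced by [psi] (section [GradedInvolution]).

    Both [f0] and [f1] are quadratic forms whose polar form is the exponent of
    [beta], that is [f (a + b) = f a + f b + beta_exp a b]. This identity makes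
    the involution an antiautomorphism ([star_mul]), and it is the closure
    axiom of skew root systems: on [f = 1] the condition [beta a b != 1] forces
    [f (a + b) = 1], and on [f = 0] the condition [beta a b != -1] forces
    [f (a + b) = 0]. Generation holds because every [g] outside the set is
    [(g + b) + b] with [b] and [g + b] in it; such a [b] can be found with one
    or two nonzero slots.

    Finally the involution satisfies [Phi (star Y) = Y^T Phi] for the
    Kronecker product [Phi] of the matrices of the forms ([star_kron_mx]).
    This [Phi] is the identity in the first case and the standard symplectic
    matrix in the second ([kron_Phi1]), so [K] is [so] or [sp] itself, up to
    the equality [2^k = 2^(k-1) + 2^(k-1)]. *)

Set Implicit Arguments.
Unset Strict Implicit.
Unset Printing Implicit Defensive.

(** * Kronecker products of two-by-two matrices *)

Section Kronecker.
Variable F : fieldType.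

Lemma castmx_mulmx (n m : nat) (e : n = m) (A B : 'M[F]_n) :
  castmx (e, e) A *m castmx (e, e) B = castmx (e, e) (A *m B).
Proof. by case: m / e. Qed.

Lemma trmx_castmx (n m : nat) (e : n = m) (A : 'M[F]_n) :
  (castmx (e, e) A)^T = castmx (e, e) A^T.
Proof. by case: m / e. Qed.

Lemma castmx_scale (n m : nat) (e : n = m) c (A : 'M[F]_n) :
  castmx (e, e) (c *: A) = c *: castmx (e, e) A.
Proof. by case: m / e. Qed.

Lemma castmx_scalar (n m : nat) (e : n = m) (c : F) :
  castmx (e, e) (c%:M : 'M_n) = c%:M.
Proof. by case: m / e. Qed.

Lemma mxtrace_castmx (n m : nat) (e : n = m) (A : 'M[F]_n) :
  \tr (castmx (e, e) A) = \tr A.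
Proof. by case: m / e. Qed.

Lemma mxtrace_tens (m n : nat) (A : 'M[F]_m) (B : 'M[F]_n) :
  \tr (A *t B) = \tr A * \tr B.
Proof. by rewrite /mxtrace mulr_sum; apply: eq_bigr => i _; rewrite mxE. Qed.

Lemma tensmx_scale (m n : nat) (a b : F) (A : 'M[F]_m) (B : 'M[F]_n) :
  (a *: A) *t (b *: B) = (a * b) *: (A *t B).
Proof. by apply/matrixP=> i j; rewrite !mxE mulrACA. Qed.

Lemma tensmx1 (m n : nat) : (1%:M : 'M[F]_m) *t (1%:M : 'M[F]_n) = 1%:M.
Proof.
apply/matrixP=> i j.
case: (mxtens_indexP i) => i1 i2; case: (mxtens_indexP j) => j1 j2.
rewrite tensmxE !mxE (can_eq (@mxtens_indexK m n)) xpair_eqE -natrM.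
by case: eqP; case: eqP.
Qed.

Lemma eq_kron k (C D : 'I_k -> 'M[F]_2) : C =1 D -> kron C = kron D.
Proof.
elim: k C D => [|k IHk] C D eqCD //=.
by rewrite eqCD (IHk _ (fun i => D (lift ord0 i))).
Qed.

Lemma kron_mul k (C D : 'I_k -> 'M[F]_2) :
  kron C *m kron D = kron (fun i => C i *m D i).
Proof.
elim: k C D => [|k IHk] C D /=; first by rewrite mulmx1.
by rewrite castmx_mulmx tensmx_mul IHk.
Qed.

Lemma trmx_kron k (C : 'I_k -> 'M[F]_2) : (kron C)^T = kron (fun i => (C i)^T).
Proof.
elim: k C => [|k IHk] C /=; first by rewrite trmx1.
by rewrite trmx_castmx trmx_tens IHk.
Qed.

Lemma kron1 k : kron (fun _ : 'I_k => 1%:M : 'M[F]_2) = 1%:M.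
Proof. by elim: k => [|k IHk] //=; rewrite IHk tensmx1 castmx_scalar. Qed.

Lemma kron_scale k (c : 'I_k -> F) (C : 'I_k -> 'M[F]_2) :
  kron (fun i => c i *: C i) = (\prod_i c i) *: kron C.
Proof.
elim: k c C => [|k IHk] c C /=; first by rewrite big_ord0 scale1r.
by rewrite IHk tensmx_scale castmx_scale big_ord_recl.
Qed.

Lemma mxtrace_kron k (C : 'I_k -> 'M[F]_2) : \tr (kron C) = \prod_i \tr (C i).
Proof.
elim: k C => [|k IHk] C /=; first by rewrite big_ord0 mxtrace1.
by rewrite mxtrace_castmx mxtrace_tens IHk big_ord_recl.
Qed.

End Kronecker.

(** * Coordinates of F_2^(2k) and the two quadratic forms *)

Lemma oppF2 (a : 'F_2) : - a = a.
Proof. by apply/val_inj; case: a => [[|[|]]]. Qed.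

Lemma F2_cases (a : 'F_2) : (a = 0) + (a = 1).
Proof. by case: a => [[|[|//]] lt]; [left | right]; apply/val_inj. Qed.

Lemma F2_neq0 (x : 'F_2) : (x != 0) = (x == 1).
Proof. by case: (F2_cases x) => ->. Qed.

Lemma F2_neq1 (x : 'F_2) : (x != 1) = (x == 0).
Proof. by case: (F2_cases x) => ->. Qed.

Lemma addrrF2 (a : 'F_2) : a + a = 0.
Proof. by case: (F2_cases a) => ->; apply/val_inj. Qed.

Section Slots.
Variable k : nat.
Local Notation G := 'rV['F_2]_(2 * k).

Definition xcoor (g : G) (i : 'I_k) : 'F_2 := coor g i.*2.+1.
Definition ycoor (g : G) (i : 'I_k) : 'F_2 := coor g i.*2.+2.

Lemma xcoorD g h i : xcoor (g + h) i = xcoor g i + xcoor h i.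
Proof. exact: coorD. Qed.

Lemma ycoorD g h i : ycoor (g + h) i = ycoor g i + ycoor h i.
Proof. exact: coorD. Qed.

Lemma coor0 n : coor (0 : G) n = 0.
Proof. by rewrite /coor; case: insub => //= i; rewrite mxE. Qed.

Lemma vec0P (g : G) :
  (forall i, xcoor g i = 0) -> (forall i, ycoor g i = 0) -> g = 0.
Proof.
move=> x0 y0; apply/rowP=> j; rewrite mxE.
have jk : (j./2 < k)%N by rewrite ltn_half_double -mul2n.
suff coorj : coor g j.+1 = 0 by move: coorj; rewrite /coor /= valK.
rewrite -[X in coor g X.+1](odd_double_half j).
by case: odd; [apply: (y0 (Ordinal jk)) | apply: (x0 (Ordinal jk))].
Qed.

(** The vectors supported in a single slot serve as test vectors: both quadratic
    forms and [beta_exp] have a closed form on them. *)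
Definition slot (i : 'I_k) (p q : 'F_2) : G :=
  \row_j if j./2 == i then (if odd j then q else p) else 0.

Lemma xcoor_slot i p q j : xcoor (slot i p q) j = if j == i then p else 0.
Proof.
rewrite /xcoor /coor /= insubT => [|lt_j] /=; first by rewrite mul2n ltn_double.
by rewrite mxE /= odd_double doubleK.
Qed.

Lemma ycoor_slot i p q j : ycoor (slot i p q) j = if j == i then q else 0.
Proof.
rewrite /ycoor /coor /= insubT => [|lt_j] /=.
  by rewrite mul2n -doubleS leq_double.
by rewrite mxE /= odd_double /= uphalf_double.
Qed.

Lemma sum_slots (V : nmodType) (E : nat -> nat -> V) :
  \sum_(1 <= i < k.+1) E i.*2.-1 i.*2 = \sum_(i < k) E i.*2.+1 i.*2.+2.
Proof. by rewrite big_add1 big_mkord. Qed.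

Lemma f0E (g : G) : f0 g = \sum_i xcoor g i * ycoor g i.
Proof. exact: (sum_slots (fun m n => coor g m * coor g n)). Qed.

(** On F_2 squares can be dropped, so that [f1] is a sum of local contributions
    indexed by the slots; the first slot carries the additional [x + y]. *)
Lemma f1E (g : G) :
  f1 g = \sum_i (xcoor g i * ycoor g i
                 + if i == 0%N :> nat then xcoor g i + ycoor g i else 0).
Proof.
have sqrF2 (a : 'F_2) : a ^+ 2 = a by apply/val_inj; case: a => [[|[|]]].
rewrite /f1 !sqrF2 -/(f0 g) f0E addrC big_split /=; congr (_ + _).
(* For [k = 0] the coordinates 1 and 2 do not exist and are read as 0. *)
rewrite -big_mkcond /=; case: (posnP k) => [k0|k_gt0].
  rewrite big_pred0 => [|[i ltik]]; last by move: (ltik); rewrite k0.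
  have coor_out n : coor g n = 0.
    by rewrite /coor insubF // k0.
  by rewrite !coor_out addr0.
by rewrite (big_pred1 (Ordinal k_gt0)).
Qed.

Lemma xi_expE (g h : G) : xi_exp g h = \sum_i ycoor g i * xcoor h i.
Proof. exact: (sum_slots (fun m n => coor g n * coor h m)). Qed.

(** In characteristic 2 the alternating form may be written with a plus sign. *)
Lemma beta_expE (g h : G) :
  beta_exp g h = \sum_i (ycoor g i * xcoor h i + xcoor g i * ycoor h i).
Proof.
transitivity (\sum_i (ycoor g i * xcoor h i - xcoor g i * ycoor h i)).
  exact: (sum_slots (fun m n => coor g n * coor h m - coor g m * coor h n)).
by apply: eq_bigr => i _; rewrite oppF2.
Qed.

Lemma beta_exp_slot (g : G) i p q :
  beta_exp g (slot i p q) = ycoor g i * p + xcoor g i * q.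
Proof.
rewrite beta_expE (bigD1 i) //= big1 ?addr0 => [|j /negPf ji].
  by rewrite xcoor_slot ycoor_slot eqxx.
by rewrite xcoor_slot ycoor_slot ji !mulr0 addr0.
Qed.

Lemma f0_slot i p q : f0 (slot i p q) = p * q.
Proof.
rewrite f0E (bigD1 i) //= big1 ?addr0 => [|j /negPf ji].
  by rewrite xcoor_slot ycoor_slot eqxx.
by rewrite xcoor_slot ji mul0r.
Qed.

Lemma f1_slot i p q :
  f1 (slot i p q) = p * q + if i == 0%N :> nat then p + q else 0.
Proof.
rewrite f1E (bigD1 i) //= big1 ?addr0 => [|j /negPf ji].
  by rewrite xcoor_slot ycoor_slot eqxx.
by rewrite xcoor_slot ycoor_slot ji mul0r !add0r; case: ifP.
Qed.

(** The only property of [f0] and [f1] on which the Lie and Jordan structures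
    depend: [f] is a quadratic form with polar form [beta_exp]. *)
Definition quadratic (f : G -> 'F_2) :=
  f 0 = 0 /\ forall a b, f (a + b) = f a + f b + beta_exp a b.

Lemma quadratic_f0 : quadratic (@f0 k).
Proof.
split=> [|a b]; first by rewrite f0E big1 // => i _; rewrite /xcoor coor0 mul0r.
rewrite beta_expE !f0E -!big_split; apply: eq_bigr => i _ /=.
by rewrite xcoorD ycoorD; ring.
Qed.

(** [f1] differs from [f0] by squares of coordinates, which are additive over F_2. *)
Lemma quadratic_f1 : quadratic (@f1 k).
Proof.
have [f00 f0D] := quadratic_f0.
have sqrD (c d : 'F_2) : (c + d) ^+ 2 = c ^+ 2 + d ^+ 2.
  by case: (F2_cases c) (F2_cases d) => [] -> [] ->; apply/val_inj.
split=> [|a b]; first by rewrite /f1 -/(f0 0) f00 !coor0 expr0n !addr0.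
by rewrite /f1 -!/(f0 _) f0D !coorD !sqrD; ring.
Qed.

End Slots.
(** * Skew root systems *)

Section SkewRoots.
Variables (k : nat) (F : fieldType).
Hypothesis F2neq0 : (2 : F) != 0.
Local Notation G := 'rV['F_2]_(2 * k).

Lemma sgn2_eq1 (x : 'F_2) : (sgn2 F x == 1) = (x == 0).
Proof.
case: (F2_cases x) => ->; rewrite /sgn2 ?eqxx //= expr1.
by rewrite eq_sym -subr_eq0 opprK (negPf F2neq0).
Qed.

Lemma sgn2_eqN1 (x : 'F_2) : (sgn2 F x == -1) = (x == 1).
Proof.
case: (F2_cases x) => ->; rewrite /sgn2 ?expr1 ?eqxx //= expr0.
by rewrite -subr_eq0 opprK (negPf F2neq0).
Qed.

Lemma addvv (g : G) : g + g = 0.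
Proof. by apply/rowP=> j; rewrite !mxE addrrF2. Qed.

Lemma oppv (g : G) : - g = g.
Proof. by apply/rowP=> j; rewrite mxE oppF2. Qed.

(** Pairing with the one-slot vectors recovers each coordinate of [g]. *)
Lemma Rad_beta : Rad (beta k F) = [set 0].
Proof.
apply/setP=> g; rewrite !inE; apply/forallP/eqP => [gRad|-> h].
  apply: vec0P => i.
  - have /= := gRad (slot i 0 1); rewrite /beta_fun sgn2_eq1 beta_exp_slot.
    by rewrite mulr0 mulr1 add0r => /eqP.
  - have /= := gRad (slot i 1 0); rewrite /beta_fun sgn2_eq1 beta_exp_slot.
    by rewrite mulr0 mulr1 addr0 => /eqP.
rewrite /= /beta_fun sgn2_eq1 beta_expE big1 // => i _.
by rewrite /xcoor /ycoor !coor0 !mul0r addrrF2.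
Qed.

(** Since [b + b = 0], an element [g] with [b] and [g + b] in [R] is a sum of two
    elements of [R]. *)
Lemma gen_of_pairs (R : {set G}) :
  (forall g, g \notin R -> exists2 b, b \in R & g + b \in R) ->
  <<R>>%g = [set: G].
Proof.
move=> sumR; apply/setP=> g; rewrite in_setT.
have [gR|/sumR[b bR gbR]] := boolP (g \in R); first exact: mem_gen.
have -> : g = ((g + b) * b)%g by rewrite /mulg /= -addrA addvv addr0.
by rewrite groupM ?mem_gen.
Qed.

Lemma opp_set (R : {set G}) : [set - a | a in R] = R.
Proof. by rewrite (eq_imset _ oppv) imset_id. Qed.

Section Quadratic.
Variable f : G -> 'F_2.
Hypothesis quad : quadratic f.

(** If [f a = f b = 1] then [f (a + b)] is [beta_exp a b], which is the closure
    axiom. The same computation for [g + b] shows that the last hypothesis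
    writes every [g] with [f g = 0] as a sum of two roots. *)
Lemma skew_root_Lie_of_quadratic :
  (0 < k)%N ->
  (forall g, f g = 0 -> exists2 b, f b = 1 & beta_exp g b = 0) ->
  skew_root_Lie (beta k F) [set a | (a != 0) && (f a == 1)].
Proof.
have [f_0 fD] := quad; move=> k_gt0 sumR.
have nz a : f a = 1 -> a != 0 by apply: contra_eqN => /eqP->; rewrite f_0.
have inR a : (a \in [set a | (a != 0) && (f a == 1)]) = (f a == 1).
  by rewrite inE andb_idl // => /eqP/nz.
rewrite /skew_root_Lie Rad_beta; split; last split.
- apply/eqP => /setP /(_ (slot (Ordinal k_gt0) 1 0)); rewrite in_set1 in_setT.
  move=> /eqP /(congr1 (fun g => xcoor g (Ordinal k_gt0))).
  by rewrite xcoor_slot eqxx /xcoor coor0.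
- by apply/subsetP => a; rewrite !inE => /andP[].
- apply: gen_of_pairs => g; rewrite inR F2_neq1 => /eqP /[dup] fg /sumR[b fb gb].
  by exists b; rewrite inR ?fD ?fg ?gb fb.
- exact: opp_set.
- move=> a b; rewrite !inR /= /beta_fun sgn2_eq1 F2_neq0 fD.
  by move=> /eqP-> /eqP-> /eqP->.
Qed.

(** Dual to the Lie case: [f a = f b = 0] gives [f (a + b) = beta_exp a b], and an
    element [g] with [f g = 1] is brought back into the set by adding some [b]
    of the set with [beta_exp g b = 1]. *)
Lemma skew_root_Jordan_of_quadratic :
  (forall g, f g = 1 -> exists2 b, f b = 0 & beta_exp g b = 1) ->
  skew_root_Jordan (beta k F) [set a | f a == 0].
Proof.
have [f_0 fD] := quad; move=> sumR; split.
- by apply/set0Pn; exists 0; rewrite inE f_0.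
- apply: gen_of_pairs => g; rewrite inE F2_neq0 => /eqP /[dup] fg /sumR[b fb gb].
  by exists b; rewrite inE ?fD ?fg ?gb fb.
- exact: opp_set.
- move=> a b; rewrite !inE /= /beta_fun sgn2_eqN1 F2_neq1 fD.
  by move=> /eqP-> /eqP-> /eqP->.
Qed.

End Quadratic.

Lemma beta_expDr (g a b : G) : beta_exp g (a + b) = beta_exp g a + beta_exp g b.
Proof.
rewrite !beta_expE -big_split; apply: eq_bigr => i _ /=.
by rewrite xcoorD ycoorD; ring.
Qed.

Lemma beta_exp_slots i j p q p' q' : i != j ->
  beta_exp (slot i p q : G) (slot j p' q') = 0.
Proof.
rewrite beta_exp_slot xcoor_slot ycoor_slot eq_sym => /negPf->.
by rewrite !mul0r addr0.
Qed.

Lemma slot_coor0 (g : G) (i : 'I_k) :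
  (forall j, j != i -> xcoor g j = 0) -> (forall j, j != i -> ycoor g j = 0) ->
  g = slot i (xcoor g i) (ycoor g i).
Proof.
move=> x0 y0; rewrite -[RHS]add0r -(addvv g) -addrA -[LHS]addr0; congr (_ + _).
apply/esym/vec0P => j.
  rewrite xcoorD xcoor_slot; case: eqP => [->|/eqP/x0->]; last exact: addr0.
  by rewrite addrrF2.
rewrite ycoorD ycoor_slot; case: eqP => [->|/eqP/y0->]; last exact: addr0.
by rewrite addrrF2.
Qed.

(** A slot of [g] with equal coordinates is orthogonal to [(1, 1)], which has
    [f0 = 1]. If there is none, each slot of [g] is [(1, 0)] or [(0, 1)]; then
    [(1, 1)] pairs nontrivially with one slot, and swapping the coordinates of
    another slot compensates this. The second slot is where [k >= 2] enters. *)
Lemma R0minus_root : (1 < k)%N -> skew_root_Lie (beta k F) (R0minus k).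
Proof.
have [f_0 fD] := quadratic_f0 k.
move=> k_gt1; have k_gt0 := ltnW k_gt1.
apply: (skew_root_Lie_of_quadratic (quadratic_f0 k)) => // g _.
have [/existsP[i /eqP xyi]|/existsPn xy] :=
  boolP [exists i, xcoor g i == ycoor g i].
  exists (slot i 1 1); first by rewrite f0_slot mulr1.
  by rewrite beta_exp_slot xyi addrrF2.
pose i := Ordinal k_gt0; pose j := Ordinal k_gt1.
exists (slot i 1 1 + slot j (ycoor g j) (xcoor g j)).
  rewrite fD beta_exp_slots // !f0_slot.
  by case: (F2_cases (xcoor g j)) (xy j) => ->;
     case: (F2_cases (ycoor g j)) => -> // _; apply/val_inj.
rewrite beta_expDr !beta_exp_slot; move: (xy i) (xy j).
by case: (F2_cases (xcoor g i)) (F2_cases (ycoor g i))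
         (F2_cases (xcoor g j)) (F2_cases (ycoor g j))
     => -> [] -> [] -> [] -> // _ _; apply/val_inj.
Qed.

(** If [f0 g = 1], some [x]-coordinate of [g] is nonzero, and the [y]-basis vector
    of that slot is isotropic and pairs to 1 with [g]. *)
Lemma R0plus_root : skew_root_Jordan (beta k F) (R0plus k).
Proof.
apply: (skew_root_Jordan_of_quadratic (quadratic_f0 k)) => g g1.
have [/existsP[i /eqP xi]|/existsPn x0] := boolP [exists i, xcoor g i == 1].
  exists (slot i 0 1); first by rewrite f0_slot mul0r.
  by rewrite beta_exp_slot xi mulr0 add0r mulr1.
have := g1; rewrite f0E big1 // => i _.
by move: (x0 i); rewrite F2_neq1 => /eqP->; rewrite mul0r.
Qed.

(** On the first slot [f1] is anisotropic: it takes the value 1 on every nonzero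
    vector. So it suffices to find a nonzero vector of that slot orthogonal to
    [g], such as the first slot of [g] itself if it is nonzero. *)
Lemma R1minus_root : (0 < k)%N -> skew_root_Lie (beta k F) (R1minus k).
Proof.
move=> k_gt0.
apply: (skew_root_Lie_of_quadratic (quadratic_f1 k)) => // g _.
pose i := Ordinal k_gt0.
have [x0|x1] := F2_cases (xcoor g i); last first.
  exists (slot i 1 (ycoor g i)).
    by rewrite f1_slot /=; case: (F2_cases (ycoor g i)) => ->; apply/val_inj.
  by rewrite beta_exp_slot x1 mulr1 mul1r addrrF2.
exists (slot i 0 1); first by rewrite f1_slot mul0r /= !add0r.
by rewrite beta_exp_slot x0 mulr0 mul0r addr0.
Qed.

(** A nonzero coordinate of [g] beyond the first slot is detected by an isotropic
    basis vector. Otherwise [g] is supported in the first slot; a vector of this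
    slot that pairs to 1 with [g] has [f1 = 1], and adding [(1, 1)] in the second
    slot corrects that value without changing the pairing. *)
Lemma R1plus_root : (1 < k)%N -> skew_root_Jordan (beta k F) (R1plus k).
Proof.
have [f_0 fD] := quadratic_f1 k.
move=> k_gt1; have k_gt0 := ltnW k_gt1.
pose i := Ordinal k_gt0; pose j := Ordinal k_gt1.
apply: (skew_root_Jordan_of_quadratic (quadratic_f1 k)) => g g1.
have [/existsP[l /andP[l0 /eqP xl]]|/existsPn x0] :=
  boolP [exists l, (l != i) && (xcoor g l == 1)].
  exists (slot l 0 1).
    by rewrite f1_slot mul0r (negPf l0 : (l == 0%N :> nat) = false) addr0.
  by rewrite beta_exp_slot xl mulr0 add0r mulr1.
have [/existsP[l /andP[l0 /eqP yl]]|/existsPn y0] :=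
  boolP [exists l, (l != i) && (ycoor g l == 1)].
  exists (slot l 1 0).
    by rewrite f1_slot mulr0 (negPf l0 : (l == 0%N :> nat) = false) addr0.
  by rewrite beta_exp_slot yl mulr0 mulr1 addr0.
have gi : g = slot i (xcoor g i) (ycoor g i).
  by apply: slot_coor0 => l li; [move: (x0 l) | move: (y0 l)];
     rewrite li /= F2_neq1 => /eqP.
have gi1 : xcoor g i != 0 \/ ycoor g i != 0.
  move: g1; rewrite gi f1_slot !xcoor_slot !ycoor_slot eqxx /=.
  by case: (F2_cases (xcoor g i)) (F2_cases (ycoor g i)) => -> [] -> //;
     [right | left | left].
have fj p q : p != 0 \/ q != 0 -> f1 (slot i p q + slot j 1 1) = 0.
  rewrite fD beta_exp_slots // !f1_slot /=.
  by case: (F2_cases p) (F2_cases q) => -> [] -> pq;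
     (by case: pq) || apply/val_inj.
have bj p q :
    beta_exp g (slot i p q + slot j 1 1) = ycoor g i * p + xcoor g i * q.
  have xj : xcoor g j = 0 by rewrite gi xcoor_slot.
  have yj : ycoor g j = 0 by rewrite gi ycoor_slot.
  by rewrite beta_expDr !beta_exp_slot xj yj !mul0r !addr0.
have [yi|yi] := F2_cases (ycoor g i).
  exists (slot i 0 1 + slot j 1 1); first by apply: fj; right.
  rewrite bj yi mulr0 add0r mulr1.
  by move: gi1; rewrite yi F2_neq0 => -[/eqP|].
exists (slot i 1 0 + slot j 1 1); first by apply: fj; left.
by rewrite bj yi mulr0 addr0 mulr1.
Qed.

End SkewRoots.
(** * The matrices X^i Y^j and the isomorphism psi *)

Section Grading.
Variables (k : nat) (F : fieldType).
Hypothesis F2neq0 : (2 : F) != 0.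
Local Notation G := 'rV['F_2]_(2 * k).

Definition XY (a b : 'F_2) : 'M[F]_2 := Xmx F ^+ a *m Ymx F ^+ b.

Lemma XYmxE (g : G) : XYmx F g = kron (fun i => XY (xcoor g i) (ycoor g i)).
Proof. by []. Qed.

Lemma mulXX : Xmx F *m Xmx F = 1%:M.
Proof.
apply/matrixP=> i j; rewrite !mxE !big_ord_recl big_ord0 !mxE.
by case: i j => [[|[|//]] ?] [[|[|//]] ?]; rewrite /= ?mulrNN; ring.
Qed.

Lemma mulYY : Ymx F *m Ymx F = 1%:M.
Proof.
apply/matrixP=> i j; rewrite !mxE !big_ord_recl big_ord0 !mxE.
by case: i j => [[|[|//]] ?] [[|[|//]] ?] /=; ring.
Qed.

Lemma mulYX : Ymx F *m Xmx F = - (Xmx F *m Ymx F).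
Proof.
apply/matrixP=> i j; rewrite !mxE !big_ord_recl !big_ord0 !mxE.
by case: i j => [[|[|//]] ?] [[|[|//]] ?] /=; ring.
Qed.

(** As [A^2 = 1], exponents may be added modulo 2. *)
Lemma expF2D (A : 'M[F]_2) (a b : 'F_2) :
  A *m A = 1%:M -> A ^+ (a + b)%R = A ^+ a *m A ^+ b.
Proof.
by move=> AA; case: (F2_cases a) (F2_cases b) => -> [] ->;
   rewrite ?(mulmx1, mul1mx, expr0, expr1) ?AA.
Qed.

Lemma commYX (b c : 'F_2) :
  Ymx F ^+ b *m Xmx F ^+ c = sgn2 F (b * c) *: (Xmx F ^+ c *m Ymx F ^+ b).
Proof.
by case: (F2_cases b) (F2_cases c) => -> [] ->; rewrite /sgn2 ?(mul0r, mulr0)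
  ?(mulmx1, mul1mx, expr0, expr1, scale1r, scaleN1r) ?mulYX.
Qed.

Lemma XY_mul a b c d : XY a b *m XY c d = sgn2 F (b * c) *: XY (a + c) (b + d).
Proof.
rewrite /XY !expF2D ?mulXX ?mulYY // -mulmxA [Ymx F ^+ b *m _]mulmxA commYX.
by rewrite -!scalemxAl -scalemxAr !mulmxA.
Qed.

Lemma mxtrace_XY a b : \tr (XY a b) = if (a == 0) && (b == 0) then 2 else 0.
Proof.
rewrite /XY; case: (F2_cases a) (F2_cases b) => -> [] ->;
  rewrite /= ?(expr0, expr1, mulmx1, mul1mx) ?mxtrace1 //.
all: rewrite /mxtrace !big_ord_recl big_ord0 !mxE ?big_ord_recl ?big_ord0 ?mxE /=.
all: by ring.
Qed.

Lemma sgn2_sum (I : finType) (E : I -> 'F_2) :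
  sgn2 F (\sum_i E i) = \prod_i sgn2 F (E i).
Proof. exact: (big_morph _ (@sgn2D F)). Qed.

Lemma XYmx_mul (g h : G) :
  XYmx F g *m XYmx F h = xi_fun F g h *: XYmx F (g + h).
Proof.
rewrite !XYmxE kron_mul /xi_fun xi_expE sgn2_sum -kron_scale.
by apply: eq_kron => i; rewrite XY_mul xcoorD ycoorD.
Qed.

Lemma mxtrace_XYmx (g : G) : \tr (XYmx F g) = if g == 0 then 2 ^+ k else 0.
Proof.
rewrite XYmxE mxtrace_kron; case: eqP => [->|/eqP g_neq0].
  under eq_bigr do rewrite mxtrace_XY /xcoor /ycoor !coor0 eqxx.
  by rewrite prodr_const card_ord.
have [/existsP[i gi]|/existsPn xy0] :=
    boolP [exists i, (xcoor g i != 0) || (ycoor g i != 0)].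
  rewrite (bigD1 i) //= mxtrace_XY.
  by rewrite -[_ && _]negbK negb_and gi mul0r.
case/eqP: g_neq0; apply: vec0P => i; move: (xy0 i); rewrite negb_or !negbK;
  by case/andP=> /eqP + /eqP.
Qed.

(** This is [xi_beta], rewritten with the fact that [beta] takes the values 1 and -1. *)
Lemma xi_fun_swap (g h : G) :
  xi_fun F g h * sgn2 F (beta_exp g h) = xi_fun F h g.
Proof.
rewrite /xi_fun -sgn2D !xi_expE beta_expE -big_split; congr sgn2.
by apply: eq_bigr => i _ /=; rewrite addrA addrrF2 add0r mulrC.
Qed.

Local Notation A := (tga (xi k F)).
Local Notation psi := (psi k F).

Lemma psiE (x : A) : psi x = \sum_g x g *: XYmx F g.
Proof. by rewrite lfunE. Qed.

Lemma psi_mul (x y : A) : psi (x * y) = psi x *m psi y.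
Proof.
rewrite [x * y]/(tga_mul x y) /tga_mul [psi x]psiE [psi y]psiE.
rewrite linear_sum mulmx_suml; apply: eq_bigr => g _.
rewrite linear_sum mulmx_sumr; apply: eq_bigr => h _.
rewrite linearZ /= psi_u -scalemxAl -scalemxAr XYmx_mul !scalerA.
by [].
Qed.

(** The products [XYmx g *m XYmx h] with [g != h] are traceless, so that the trace
    isolates the coordinate of [x] at [h]. *)
Lemma psi_trace (x : A) h :
  \tr (psi x *m XYmx F h) = x h * xi_fun F h h * 2 ^+ k.
Proof.
rewrite psiE mulmx_suml raddf_sum (bigD1 h) //= big1 => [|g gh].
  rewrite -scalemxAl XYmx_mul !mxtraceZ mxtrace_XYmx addvv eqxx.
  by rewrite addr0 mulrA.
rewrite -scalemxAl XYmx_mul !mxtraceZ mxtrace_XYmx -[h in g + h]oppv subr_eq0.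
by rewrite (negPf gh) !mulr0.
Qed.

Lemma psi_inj : injective psi.
Proof.
move=> x y eq_xy; apply/ffunP=> h.
have := psi_trace y h; rewrite -eq_xy psi_trace.
by move/(mulIf (expf_neq0 _ F2neq0))/(mulIf (xi_fun_neq0 _ _ _)).
Qed.

(** Both spaces have dimension [4^k]. *)
Lemma limg_psi : limg psi = fullv.
Proof.
have ker0 : lker psi = 0%VS by apply/eqP/lker0P/psi_inj.
apply/eqP; rewrite eqEdim subvf limg_dim_eq ?ker0 ?capv0 // !dimvf.
have -> : dim A = (#|{: G}| * 1)%N by [].
have -> : dim 'M[F]_(2 ^ k) = (2 ^ k * 2 ^ k)%N by [].
by rewrite card_mx card_ord mul1n muln1 -expnD addnn -mul2n; exact: leqnn.
Qed.

Lemma psi_surj (Y : 'M[F]_(2 ^ k)) : exists x, Y = psi x.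
Proof.
have /memv_imgP[x _ ->] : Y \in limg psi by rewrite limg_psi memvf.
by exists x.
Qed.

Lemma XYmx_neq0 (g : G) : XYmx F g != 0.
Proof.
apply/eqP => g0; have := psi_trace (tga_u _ g) g.
rewrite psi_u g0 mul0mx mxtrace0 ffunE eqxx mul1r => /esym/eqP; apply/negP.
apply: mulf_neq0; [exact: xi_fun_neq0 | exact: expf_neq0].
Qed.

Lemma eq_linear_on_XYmx (V : lmodType F) (S T : {linear 'M[F]_(2 ^ k) -> V}) :
  (forall g : G, S (XYmx F g) = T (XYmx F g)) -> S =1 T.
Proof.
move=> eqST Y; have [x ->] := psi_surj Y.
by rewrite psiE !linear_sum; apply: eq_bigr => g _; rewrite !linearZ /= eqST.
Qed.

Lemma mem_tga_span (R : {set G}) (x : A) :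
  (x \in tga_span (xi k F) R) = [forall g, (x g != 0) ==> (g \in R)].
Proof.
apply/idP/forallP => [/memv_sumP[v vR ->] g|xR].
  apply/implyP; apply: contraNT => gR; rewrite sum_ffunE big1 // => h hR.
  have /vlineP[c ->] := vR h hR; rewrite !ffunE /GRing.scale /=.
  by case: eqP gR => [->|]; rewrite ?hR ?mulr0.
rewrite (tga_sum x); apply: memv_suml => g _.
have [->|xg] := eqVneq (x g) 0; first by rewrite scale0r mem0v.
apply: subvP (memvZ _ (memv_line _)).
by apply: (sumv_sup g) => //; apply: (implyP (xR g)).
Qed.

(** * An involution acting by signs on the grading *)

Section GradedInvolution.
Variables (f : G -> 'F_2) (star : 'End('M[F]_(2 ^ k))).
Hypothesis quad : quadratic f.
Hypothesis starE : forall g : G, star (XYmx F g) = sgn2 F (f g) *: XYmx F g.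

(** [K] and [H] are the eigenspaces of the involution for -1 and 1; indexing the
    eigenvalue by its exponent in F_2 treats both at once. *)
Definition eigen (e : 'F_2) (V : {vspace 'M[F]_(2 ^ k)}) :=
  forall Y, (Y \in V) = (star Y == sgn2 F e *: Y).

Lemma eigen_K : eigen 1 (Kspace star).
Proof. by move=> Y; rewrite mem_Kspace /sgn2 expr1 scaleN1r. Qed.

Lemma eigen_H : eigen 0 (Hspace star).
Proof. by move=> Y; rewrite mem_Hspace /sgn2 expr0 scale1r. Qed.

Lemma star_psi (x : A) : star (psi x) = psi [ffun g => sgn2 F (f g) * x g].
Proof.
rewrite !psiE linear_sum; apply: eq_bigr => g _.
by rewrite linearZ /= starE ffunE scalerA mulrC.
Qed.

Lemma sgn2_inj : injective (sgn2 F).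
Proof.
move=> a b eq_ab; apply/eqP; rewrite -subr_eq0 oppF2 -(sgn2_eq1 F2neq0).
by rewrite sgn2D eq_ab -sgn2D addrrF2.
Qed.

Lemma eigen_psi e V (x : A) : eigen e V ->
  (psi x \in V) = (x \in tga_span (xi k F) [set g | f g == e]).
Proof.
move=> eV; rewrite eV star_psi -linearZ (inj_eq psi_inj) mem_tga_span.
apply/eqP/forallP => [eq_x g|xR]; last first.
  apply/ffunP=> g; rewrite !ffunE.
  have [->|/(implyP (xR g))] := eqVneq (x g) 0; first by rewrite scaler0 mulr0.
  by rewrite inE => /eqP->.
apply/implyP=> xg; rewrite inE.
by move/ffunP/(_ g): eq_x; rewrite !ffunE => /(mulIf xg)/sgn2_inj->.
Qed.

(** The components are lines, so one meets the eigenspace nontrivially exactly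
    when its generator has the right eigenvalue. *)
Lemma support_eigen e V : eigen e V ->
  grading_support V = [set g | f g == e].
Proof.
move=> eV; apply/setP=> g; rewrite !inE; apply/idP/eqP => [|fg]; last first.
  have: XYmx F g \in (V :&: M_component F g)%VS.
    by rewrite memv_cap memv_line andbT eV starE fg.
  by apply: contraTneq => ->; rewrite memv0 XYmx_neq0.
rewrite -vpick0; set v := vpick _ => v_neq0.
have := memv_pick (V :&: M_component F g)%VS; rewrite -/v memv_cap.
case/andP=> /[swap] /vlineP[c v_eq]; rewrite v_eq in v_neq0 *.
rewrite eV linearZ /= starE scalerA mulrC -scalerA.
rewrite -subr_eq0 -scalerBl scaler_eq0 (negPf v_neq0) orbF subr_eq0.
by move/eqP/sgn2_inj.
Qed.

(** On basis elements the claim is [xi g h * (-1)^(f (g + h))] equals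
    [xi h g * (-1)^(f g + f h)], and the polar form of [f] accounts for the
    exchange of the arguments of [xi]. *)
Lemma star_mul (Y Z : 'M[F]_(2 ^ k)) : star (Y *m Z) = star Z *m star Y.
Proof.
have [_ fD] := quad.
have [x ->] := psi_surj Y; have [y ->] := psi_surj Z; rewrite !psiE.
rewrite mulmx_suml !linear_sum; apply: eq_bigr => g _ /=.
rewrite mulmx_sumr mulmx_suml linear_sum; apply: eq_bigr => h _ /=.
rewrite -scalemxAl -scalemxAr XYmx_mul !linearZ /= !starE.
rewrite -!scalemxAl -!scalemxAr XYmx_mul !scalerA [h + g]addrC; congr (_ *: _).
by rewrite fD !sgn2D -(xi_fun_swap g h); ring.
Qed.

Lemma lie_mul_K :
  {in Kspace star &, forall Y Z, lie_mul mulmx Y Z \in Kspace star}.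
Proof.
move=> Y Z; rewrite !mem_Kspace /lie_mul => /eqP SY /eqP SZ.
by rewrite linearB /= !star_mul SY SZ !(mulmxN, mulNmx) !opprK opprB.
Qed.

Lemma jordan_mul_H :
  {in Hspace star &, forall Y Z, jordan_mul mulmx Y Z \in Hspace star}.
Proof.
move=> Y Z; rewrite !mem_Hspace /jordan_mul => /eqP SY /eqP SZ.
by rewrite linearZ /= linearD /= !star_mul SY SZ addrC.
Qed.

(** Since [psi] is bijective and multiplicative, closure of the span in the
    twisted group algebra is pulled back from that of [V]. *)
Lemma induces_iso_psi (mulU : A -> A -> A)
    (mulV : 'M[F]_(2 ^ k) -> 'M_(2 ^ k) -> 'M_(2 ^ k))
    (R : {set G}) (V : {vspace 'M[F]_(2 ^ k)}) :
  {morph psi : x y / mulU x y >-> mulV x y} ->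
  {in V &, forall Y Z, mulV Y Z \in V} ->
  (forall x : A, (psi x \in V) = (x \in tga_span (xi k F) R)) ->
  induces_iso mulU mulV (tga_span (xi k F) R) V psi.
Proof.
move=> morph_psi mulV_closed memV; split=> //.
- by move=> x y xR yR; rewrite -memV morph_psi mulV_closed ?memV.
- by move=> x y _ _; apply: psi_inj.
- apply/vspaceP=> Y; apply/memv_imgP/idP => [[x xR ->]|YV].
    by rewrite memV.
  by have [x Yx] := psi_surj Y; exists x; rewrite // -memV -Yx.
Qed.

Lemma psi_Lie_iso : psi_induces_Lie_iso [set g | f g == 1] (Kspace star).
Proof.
apply: induces_iso_psi lie_mul_K _ => [x y|x]; last exact: eigen_psi eigen_K.
by rewrite /lie_mul linearB /= !psi_mul.
Qed.

Lemma psi_Jordan_iso : psi_induces_Jordan_iso [set g | f g == 0] (Hspace star).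
Proof.
apply: induces_iso_psi jordan_mul_H _ => [x y|x]; last exact: eigen_psi eigen_H.
by rewrite /jordan_mul linearZ /= linearD /= !psi_mul.
Qed.

End GradedInvolution.

End Grading.
(** * Bilinear forms and their involutions *)

Section Forms.
Variables (F : fieldType) (n : nat).

Lemma form_mxE (phi : {biscalar 'cV[F]_n}) u v :
  phi u v = (u^T *m form_mx phi *m v) 0 0.
Proof.
have basisE (w : 'cV[F]_n) : w = \sum_i w i 0 *: delta_mx i 0.
  apply/matrixP=> i j; rewrite summxE (bigD1 i) //= big1 => [|l li].
    by rewrite !mxE ord1 !eqxx mulr1 addr0.
  by rewrite !mxE eq_sym (negPf li) mulr0.
rewrite {1}(basisE u) {1}(basisE v) linear_sumr.
rewrite mxE; apply: eq_bigr => j _; rewrite linearZr_LR linear_sumlz mxE mulrC.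
rewrite !mulr_suml; apply: eq_bigr => i _.
by rewrite linearZl_LR !mxE.
Qed.

(** The matrix version of the adjunction [phi (X u) v = phi u (X^* v)]; unlike
    [X^* = Phi^-1 X^t Phi] it makes no use of the inverse. *)
Lemma involution_form_mx (phi : {biscalar 'cV[F]_n}) inv :
  involution_of_form phi inv ->
  forall X, form_mx phi *m inv X = X^T *m form_mx phi.
Proof.
move=> inv_phi X; apply/matrixP=> i j.
have := inv_phi X (delta_mx i 0) (delta_mx j 0); rewrite !form_mxE.
rewrite trmx_mul trmx_delta -!mulmxA -!rowE !mulmxA -!colE.
by rewrite !mxE => ->.
Qed.

Definition mxform (Phi : 'M[F]_n) (u v : 'cV[F]_n) : F := (u^T *m Phi *m v) 0 0.

Lemma mxform_bilinear Phi : bilinear_for *%R *%R (mxform Phi).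
Proof.
split=> [v|u] c w1 w2; rewrite /mxform.
- by rewrite linearP /= mulmxDl mulmxDl -!scalemxAl !mxE.
- by rewrite mulmxDr -scalemxAr !mxE.
Qed.
HB.instance Definition _ Phi := bilinear_isBilinear.Build F _ _ _ _ _
  (mxform Phi) (mxform_bilinear Phi).

Variables (Phi : 'M[F]_n) (star : 'End('M[F]_n)).

Lemma mxform_nonsingular : Phi \in unitmx -> form_nonsingular (mxform Phi).
Proof.
move=> Phi_unit u u0; apply: trmx_inj.
apply: (can_inj (mulmxK Phi_unit)); rewrite trmx0 mul0mx.
apply/rowP=> j; rewrite [RHS]mxE.
have := u0 (delta_mx j 0); by rewrite /= /mxform -colE mxE => <-.
Qed.

Lemma mxformT u v : mxform Phi u v = mxform Phi^T v u.
Proof.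
have tr11 (w : 'M[F]_1) : w 0 0 = w^T 0 0 by rewrite mxE.
by rewrite /mxform tr11 !trmx_mul trmxK mulmxA.
Qed.

Lemma mxform_symmetric : Phi^T = Phi -> form_symmetric (mxform Phi).
Proof. by move=> PhiT u v; rewrite /= mxformT PhiT. Qed.

Lemma mxform_skew : Phi^T = - Phi -> form_skew (mxform Phi).
Proof.
by move=> PhiT u v; rewrite /= mxformT PhiT /mxform mulmxN mulNmx mxE.
Qed.

Lemma mxform_involution : (forall X, Phi *m star X = X^T *m Phi) ->
  involution_of_form (mxform Phi) star.
Proof.
move=> starP X u v; rewrite /= /mxform trmx_mul -!mulmxA !(mulmxA Phi) starP.
by rewrite !mulmxA.
Qed.

End Forms.

(** * Tensor products of involutions of two-by-two matrices *)

Section TensorInvolution.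
Variables (k : nat) (F : fieldType).
Hypothesis F2neq0 : (2 : F) != 0.
Local Notation G := 'rV['F_2]_(2 * k).

Variables (phi : 'I_k -> {biscalar 'cV[F]_2}).
Variables (inv : 'I_k -> 'M[F]_2 -> 'M[F]_2).
Variables (star : 'End('M[F]_(2 ^ k))) (Phi : 'I_k -> 'M[F]_2).
Hypothesis inv_phi : forall i, involution_of_form (phi i) (inv i).
Hypothesis star_inv : tensor_involution inv star.
Hypothesis phi_mx : forall i, form_mx (phi i) = Phi i.

(** Both sides are linear in [Y], so it is enough to compare them on the basis of
    pure tensors [XYmx g], where the identity holds factor by factor. *)
Lemma star_kron_mx Y : kron Phi *m star Y = Y^T *m kron Phi.
Proof.
apply: (eq_linear_on_XYmx F2neq0 (S := mulmx (kron Phi) \o star)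
                              (T := mulmxr (kron Phi) \o trmx)) => g.
rewrite /= XYmxE star_inv trmx_kron !kron_mul; apply: eq_kron => i.
by rewrite -phi_mx involution_form_mx.
Qed.

(** If the involution of the [i]-th factor multiplies [X^a Y^b] by
    [(-1)^(e i a b)], these signs multiply over the factors. *)
Lemma star_XYmx (e : 'I_k -> 'F_2 -> 'F_2 -> 'F_2) (g : G) :
  (forall i, Phi i \in unitmx) ->
  (forall i a b,
     (XY F a b)^T *m Phi i = sgn2 F (e i a b) *: (Phi i *m XY F a b)) ->
  star (XYmx F g) = sgn2 F (\sum_i e i (xcoor g i) (ycoor g i)) *: XYmx F g.
Proof.
move=> Phi_unit XY_Phi; rewrite XYmxE star_inv sgn2_sum -kron_scale.
apply: eq_kron => i; apply: (can_inj (mulKmx (Phi_unit i))).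
by rewrite -[in LHS]phi_mx involution_form_mx // phi_mx XY_Phi scalemxAr.
Qed.

End TensorInvolution.

Section Factors.
Variable F : fieldType.

Lemma trmx_XY a b : (XY F a b)^T = sgn2 F (a * b) *: XY F a b.
Proof.
have XT : (Xmx F)^T = Xmx F.
  by apply/matrixP=> i j; rewrite !mxE eq_sym; case: eqP => // ->.
have YT : (Ymx F)^T = Ymx F by apply/matrixP=> i j; rewrite !mxE eq_sym.
have expT (A : 'M[F]_2) (c : 'F_2) : A^T = A -> (A ^+ c)^T = A ^+ c.
  by case: (F2_cases c) => -> AT; rewrite ?expr0 ?expr1 // trmx1.
by rewrite /XY trmx_mul !expT // commYX mulrC.
Qed.

(** [Phi1] anticommutes with [X] and with [Y], whence the sign [(-1)^(a + b)] in
    addition to that of the transpose. *)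
Lemma XY_Phi1 a b :
  (XY F a b)^T *m Phi1 F = sgn2 F (a * b + (a + b)) *: (Phi1 F *m XY F a b).
Proof.
rewrite trmx_XY -scalemxAl sgn2D -scalerA; congr (_ *: _).
have XP : Xmx F *m Phi1 F = - (Phi1 F *m Xmx F).
  apply/matrixP=> i j; rewrite !mxE !big_ord_recl !big_ord0 !mxE.
  by case: i j => [[|[|//]] ?] [[|[|//]] ?] /=; ring.
have YP : Ymx F *m Phi1 F = - (Phi1 F *m Ymx F).
  apply/matrixP=> i j; rewrite !mxE !big_ord_recl !big_ord0 !mxE.
  by case: i j => [[|[|//]] ?] [[|[|//]] ?] /=; ring.
have expP (A : 'M[F]_2) (c : 'F_2) :
    A *m Phi1 F = - (Phi1 F *m A) ->
    A ^+ c *m Phi1 F = sgn2 F c *: (Phi1 F *m A ^+ c).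
  by case: (F2_cases c) => -> AP;
     rewrite /sgn2 ?expr0 ?expr1 ?mulmx1 ?mul1mx ?scale1r ?scaleN1r.
rewrite /XY -mulmxA (expP _ b YP) -scalemxAr !mulmxA (expP _ a XP).
by rewrite -scalemxAl scalerA sgn2D mulrC.
Qed.

Lemma Phi1_sqr : Phi1 F *m Phi1 F = - 1%:M.
Proof.
apply/matrixP=> i j; rewrite !mxE !big_ord_recl !big_ord0 !mxE.
by case: i j => [[|[|//]] ?] [[|[|//]] ?] /=; ring.
Qed.

Lemma Phi1_tr : (Phi1 F)^T = - Phi1 F.
Proof.
by apply/matrixP=> i j; rewrite !mxE;
   case: i j => [[|[|//]] ?] [[|[|//]] ?] /=; rewrite ?oppr0 ?opprK.
Qed.

Lemma Phi1_unit : Phi1 F \in unitmx.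
Proof.
have : Phi1 F *m (- Phi1 F) = 1%:M by rewrite mulmxN Phi1_sqr opprK.
by case/mulmx1_unit.
Qed.

End Factors.

(** * Identification with so and sp *)

Section Models.
Variable F : fieldType.

Lemma expnS_add k : (2 ^ k.+1 = 2 ^ k + 2 ^ k)%N.
Proof. by rewrite expnS mul2n addnn. Qed.

Definition Phi_sp k (i : 'I_k) : 'M[F]_2 :=
  if i == 0%N :> nat then Phi1 F else 1%:M.

(** With the first factor outermost, [Phi1] tensored with the identity is the
    block matrix with blocks [0, 1, -1, 0]. *)
Lemma kron_Phi1 k :
  castmx (expnS_add k, expnS_add k) (kron (@Phi_sp k.+1))
  = symplectic_mx F (2 ^ k).
Proof.
rewrite /= /Phi_sp /= kron1 castmx_comp.
have -> : Phi1 F = block_mx 0 (1 : 'M_1) (-1) 0 :> 'M_(1 + 1).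
  apply/matrixP=> i j; rewrite !mxE.
  case: (splitP i) => i' /= ei; rewrite !mxE;
  case: (splitP j) => j' /= ej; rewrite !mxE;
  rewrite -!val_eqE /= ei ej !ord1 //.
rewrite tens_block_mx !tens0mx tens_scalar1mx tens_scalarN1mx castmx_comp.
rewrite (castmx_block (mul1n _) (mul1n _) (mul1n _) (mul1n _)).
by rewrite !castmx_comp !castmx_id !castmx_const.
Qed.

Lemma Lie_iso_castmx n m (e : n = m)
    (A : {vspace 'M[F]_n}) (B : {vspace 'M[F]_m}) :
  (forall X, (castmx (e, e) X \in B) = (X \in A)) ->
  {in A &, forall X Y, lie_mul mulmx X Y \in A} ->
  Lie_iso A B.
Proof.
case: m / e B => B eqAB lieA; have {eqAB} -> : B = A.
  by apply/vspaceP=> X; rewrite -eqAB castmx_id.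
exists \1%VF; split=> // [X Y _ _|  |X Y _ _]; first by rewrite !lfunE.
  exact: lim1g.
by rewrite !lfunE.
Qed.

Lemma sp_castmx k (X : 'M[F]_(2 ^ k.+1)) :
  (castmx (expnS_add k, expnS_add k) X \in sp F (2 ^ k)) =
  (X^T *m kron (@Phi_sp k.+1) == - (kron (@Phi_sp k.+1) *m X)).
Proof.
have castmxN n m (e : n = m) (Z : 'M[F]_n) :
    castmx (e, e) (- Z) = - castmx (e, e) Z by case: m / e.
rewrite mem_sp -kron_Phi1 trmx_castmx !castmx_mulmx -castmxN.
by rewrite (inj_eq (can_inj (castmxK _ _))).
Qed.

Lemma Phi_sp_unit k (i : 'I_k) : Phi_sp i \in unitmx.
Proof. by rewrite /Phi_sp; case: ifP => _; rewrite ?unitmx1 ?Phi1_unit. Qed.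

Lemma kron_Phi_sp_unit k : kron (@Phi_sp k) \in unitmx.
Proof.
have : kron (@Phi_sp k) *m kron (fun i => invmx (Phi_sp i)) = 1%:M.
  by rewrite kron_mul -kron1; apply: eq_kron => i; rewrite mulmxV ?Phi_sp_unit.
by case/mulmx1_unit.
Qed.

Lemma kron_Phi_sp_tr k : (0 < k)%N -> (kron (@Phi_sp k))^T = - kron (@Phi_sp k).
Proof.
move=> k_gt0; pose c (i : 'I_k) : F := if i == 0%N :> nat then -1 else 1.
have prod_c : \prod_i c i = -1.
  by rewrite -big_mkcond (big_pred1 (Ordinal k_gt0)).
rewrite -scaleN1r -prod_c -kron_scale trmx_kron; apply: eq_kron => i.
rewrite /Phi_sp /c; case: ifP => _; rewrite ?scaleN1r ?scale1r ?trmx1 //.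
exact: Phi1_tr.
Qed.

(** As [Phi] is invertible, [star X = - X] amounts to [X^T Phi = - Phi X], which
    is the equation of [sp]. *)
Lemma Kspace_iso_sp k (star : 'End('M[F]_(2 ^ k))) : (0 < k)%N ->
  (forall Y, kron (@Phi_sp k) *m star Y = Y^T *m kron (@Phi_sp k)) ->
  {in Kspace star &, forall X Y, lie_mul mulmx X Y \in Kspace star} ->
  Lie_iso (Kspace star) (sp F (2 ^ k.-1)).
Proof.
case: k star => // k star _ starP lieK.
apply: (Lie_iso_castmx (e := expnS_add k)) lieK => X.
rewrite sp_castmx mem_Kspace -starP -mulmxN.
by rewrite (inj_eq (can_inj (mulKmx (kron_Phi_sp_unit _)))).
Qed.
End Models.
(** * The orthogonal and the symplectic case *)

Lemma Rminus_quadratic k (f : 'rV['F_2]_(2 * k) -> 'F_2) : quadratic f ->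
  [set a | (a != 0) && (f a == 1)] = [set a | f a == 1].
Proof.
move=> [f_0 _]; apply/setP=> a; rewrite !inE andb_idl // => /eqP fa.
by apply: contra_eqN fa => /eqP->; rewrite f_0.
Qed.

Theorem proposition5p11 (F : closedFieldType) (charF0 : [pchar F] =i pred0)
    (k : nat) (k_gt0 : (0 < k)%N)
    (phi : 'I_k -> {biscalar 'cV[F]_2})
    (phi_nonsingular : forall i, form_nonsingular (phi i))
    (phi_sym_or_skew : forall i, form_symmetric (phi i) \/ form_skew (phi i))
    (inv : 'I_k -> 'M[F]_2 -> 'M[F]_2)
    (inv_phi : forall i, involution_of_form (phi i) (inv i))
    (star : 'End('M[F]_(2 ^ k)))
    (star_inv : tensor_involution inv star) :
  (number_of_skew_forms phi 0 ->
   (forall i, form_mx (phi i) = 1%:M) ->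
   [/\ Lie_iso (Kspace star) (so F (2 ^ k)) /\ Jordan_type_HF (Hspace star),
       grading_support (Kspace star) = R0minus k /\
       grading_support (Hspace star) = R0plus k,
       ((2 <= k)%N -> skew_root_Lie (beta k F) (R0minus k)) /\
       skew_root_Jordan (beta k F) (R0plus k),
       (2 <= k)%N -> psi_induces_Lie_iso (R0minus k) (Kspace star)
     & psi_induces_Jordan_iso (R0plus k) (Hspace star)])
  /\
  (number_of_skew_forms phi 1 ->
   (forall i : 'I_k, form_mx (phi i) = if i == 0%N :> nat then Phi1 F else 1%:M) ->
   [/\ Lie_iso (Kspace star) (sp F (2 ^ k.-1)) /\ Jordan_type_HQ (Hspace star),
       grading_support (Kspace star) = R1minus k /\
       grading_support (Hspace star) = R1plus k,
       skew_root_Lie (beta k F) (R1minus k) /\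
       ((2 <= k)%N -> skew_root_Jordan (beta k F) (R1plus k)),
       psi_induces_Lie_iso (R1minus k) (Kspace star)
     & (2 <= k)%N -> psi_induces_Jordan_iso (R1plus k) (Hspace star)]).
Proof.
have F2neq0 : (2 : F) != 0 by have := charF0 2%N; rewrite inE /= => /negbT.
split=> _ phi_mx.
- have quad := quadratic_f0 k.
  have starE g : star (XYmx F g) = sgn2 F (f0 g) *: XYmx F g.
    rewrite f0E (star_XYmx inv_phi star_inv phi_mx (e := fun _ a b => a * b)) //.
      by move=> i; rewrite unitmx1.
    by move=> i a b; rewrite mulmx1 mul1mx trmx_XY.
  have starT Y : star Y = Y^T.
    have := star_kron_mx F2neq0 inv_phi star_inv phi_mx Y.
    by rewrite kron1 mul1mx mulmx1.
  rewrite /R0minus Rminus_quadratic //; split; first split.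
  + have lieK := lie_mul_K F2neq0 quad starE.
    apply: (Lie_iso_castmx (e := erefl _)) lieK => X.
    by rewrite castmx_id mem_so mem_Kspace starT.
  + exists (mxform 1%:M), star; split=> //.
    * by apply: mxform_nonsingular; rewrite unitmx1.
    * by apply: mxform_symmetric; rewrite trmx1.
    * by apply: mxform_involution => X; rewrite mul1mx mulmx1.
  + split; first exact: (support_eigen F2neq0 starE (eigen_K _)).
    exact: (support_eigen F2neq0 starE (eigen_H _)).
  + rewrite -Rminus_quadratic //; split; first exact: R0minus_root.
    exact: R0plus_root.
  + by move=> _; apply: psi_Lie_iso.
  + exact: psi_Jordan_iso.
- have quad := quadratic_f1 k.
  have starE g : star (XYmx F g) = sgn2 F (f1 g) *: XYmx F g.
    rewrite f1E; apply: (star_XYmx inv_phi star_inv phi_mx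
       (e := fun i a b => a * b + if i == 0%N :> nat then a + b else 0)).
      exact: Phi_sp_unit.
    move=> i a b.
    case: ifP => _; first exact: XY_Phi1.
    by rewrite mulmx1 mul1mx addr0 trmx_XY.
  have starP := star_kron_mx F2neq0 inv_phi star_inv phi_mx.
  rewrite /R1minus Rminus_quadratic //; split; first split.
  + have lieK := lie_mul_K F2neq0 quad starE.
    exact: Kspace_iso_sp.
  + split; first by rewrite oddX orbF -lt0n k_gt0.
    exists (mxform (kron (@Phi_sp F k))), star; split=> //.
    * by apply: mxform_nonsingular; apply: kron_Phi_sp_unit.
    * by apply: mxform_skew; apply: kron_Phi_sp_tr.
    * exact: mxform_involution.
  + split; first exact: (support_eigen F2neq0 starE (eigen_K _)).
    exact: (support_eigen F2neq0 starE (eigen_H _)).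
  + rewrite -Rminus_quadratic //; split; first exact: R1minus_root.
    exact: R1plus_root.
  + exact: psi_Lie_iso.
  + by move=> _; apply: psi_Jordan_iso.
Qed.
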